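(* Let $G$ be a graph and $H$ be a cover of $G$. If $H$ has a strictly $f$-degenerate transversal whenever $f$ is a function from $V(H)$ to $\{0, 1, 2\}$ and $f(v, 1) + f(v, 2) + \dots + f(v, s) \geq k$ for each vertex $v \in V(G)$, then $G$ is DP-$k$-colorable, and the list vertex arboricity of $G$ is at most $\lceil\frac{k}{2}\rceil$.
   Context: All graphs are simple, finite and undirected; $s$ is a positive integer and $k$ is an integer. A cover of a graph $G$ is a graph $H$ with vertex set $\bigcup_{v \in V(G)} X_v$, where $X_v = \{(v,1), \dots, (v,s)\}$, and edge set $\bigcup_{uv \in E(G)} \mathscr{M}_{uv}$, where each $\mathscr{M}_{uv}$ is a (possibly empty) matching between $X_u$ and $X_v$. A set $R \subseteq V(H)$ is a transversal of $H$ if $|R \cap X_v| = 1$ for each $v \in V(G)$. A graph with a nonnegative integer valued function $f$ on its vertices is strictly $f$-degenerate if every nonempty subgraph $\Gamma$ of it has a vertex $x$ with $\deg_\Gamma(x) < f(x)$. For a function $f$ from $V(H)$ to the nonnegative integers (write $f(v,q)$ for $f((v,q))$), a transversal $R$ is a strictly $f$-degenerate transversal if the induced subgraph $H[R]$ is strictly $f$-degenerate. If $f$ takes values in $\{0,1\}$, a DP-coloring of $(H,f)$ is a strictly $f$-degenerate transversal of $H$. The DP-chromatic number of $G$ is the least integer $k$ such that $(H,f)$ has a DP-coloring whenever $H$ is a cover of $G$ and $f$ is a function from $V(H)$ to $\{0,1\}$ with $f(v,1) + f(v,2) + \dots + f(v,s) \geq k$ for each $v \in V(G)$. $G$ is DP-$k$-colorable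 if its DP-chromatic number is at most $k$. A list $k$-assignment $L$ assigns to each vertex $v$ a set $L(v)$ of colors with $|L(v)| \geq k$. An $L$-forested-coloring of $G$ is a (not necessarily proper) coloring $\phi$ such that $\phi(v) \in L(v)$ for each $v \in V(G)$ and each color class induces a forest. The list vertex arboricity of $G$ is the least integer $k$ such that $G$ has an $L$-forested-coloring for any list $k$-assignment $L$.
   Formalization: The hypothesis is required of every cover H of G, for every s, not of one fixed H (for one H with empty matchings over a complete graph and k = 1 the claim fails); G is assumed to have at least one vertex, so that the least integers exist. *)

(* Defs.v *)
From HB Require Import structures.
From mathcomp Require Import all_boot all_order all_algebra finmap.

Set Implicit Arguments.
Unset Strict Implicit.
Unset Printing Implicit Defensive.

Import Order.TTheory GRing.Theory Num.Theory.

Record sgraph (V : finType) := SGraph {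
  adj : rel V;
  adj_sym : symmetric adj;
  adj_irr : irreflexive adj }.

Definition induced (V : finType) (G : sgraph V) (S : {set V}) :
    sgraph {x : V | x \in S} :=
  @SGraph _ (relpre val (adj G))
    (fun x y => adj_sym G (val x) (val y)) (fun x => adj_irr G (val x)).

Record subgraph (V : finType) (G : sgraph V) := Subgraph {
  sub_verts : {set V};
  sub_adj : rel V;
  sub_adj_sym : symmetric sub_adj;
  sub_adj_verts : forall x y, sub_adj x y -> x \in sub_verts;
  sub_adj_sub : subrel sub_adj (adj G) }.

Definition sub_deg (V : finType) (G : sgraph V) (Gamma : subgraph G) (x : V) :=
  #|[set y | sub_adj Gamma x y]|.

Definition strictly_degenerate (V : finType) (G : sgraph V) (f : V -> nat) :=
  forall Gamma : subgraph G, sub_verts Gamma != set0 ->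
    exists2 x, x \in sub_verts Gamma & sub_deg Gamma x < f x.

(* The vertex set of a cover is V * 'I_s, with fibres X_v = {v} * 'I_s (the   *)
(* second coordinate is numbered from 0). As adj H is symmetric, the second   *)
(* clause says that two edges between X_u and X_v sharing an endpoint, on     *)
(* either side, are equal, i.e. that these edges form a matching.             *)
Definition is_cover (V : finType) (s : nat) (G : sgraph V)
    (H : sgraph (V * 'I_s)%type) :=
  (forall p q, adj H p q -> adj G p.1 q.1) /\
  (forall p q q', adj H p q -> adj H p q' -> q.1 = q'.1 -> q = q').

Definition is_transversal (V : finType) (s : nat) (R : {set V * 'I_s}) :=
  forall v, #|R :&: [set p | p.1 == v]| = 1.

Definition strictly_degenerate_transversal (V : finType) (s : nat)
    (H : sgraph (V * 'I_s)%type) (f : V * 'I_s -> nat) (R : {set V * 'I_s}) :=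
  is_transversal R /\ strictly_degenerate (induced H R) (fun x => f (val x)).

(* Every cover, of any fibre size s > 0, has a strictly f-degenerate          *)
(* transversal as soon as f takes values in {0, ..., m} and its sum over each *)
(* fibre is at least k.                                                       *)
Definition has_transversals (V : finType) (G : sgraph V) (m : nat) (k : int) :=
  forall (s : nat) (H : sgraph (V * 'I_s)%type) (f : V * 'I_s -> nat),
    0 < s -> is_cover G H ->
    (forall p, f p <= m) ->
    (forall v, (k <= (\sum_(q < s) f (v, q))%:Z)%R) ->
    exists R, strictly_degenerate_transversal H f R.

(* On the null graph all integers satisfy the predicates below, so a least    *)
(* one exists only for graphs with a nonempty vertex set.                     *)
Definition is_least (P : int -> Prop) (d : int) :=
  P d /\ (forall d' : int, P d' -> (d <= d')%R).

Definition is_DP_chromatic_number (V : finType) (G : sgraph V) :=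
  is_least (has_transversals G 1).

Definition DP_colorable (V : finType) (G : sgraph V) (k : int) :=
  exists2 d, is_DP_chromatic_number G d & (d <= k)%R.

(* ucycle also holds for single vertices and single edges, hence the bound.   *)
Definition is_forest (V : finType) (G : sgraph V) :=
  forall c : seq V, 2 < size c -> ~ ucycle (adj G) c.

Definition forested_coloring (V : finType) (G : sgraph V) (C : choiceType)
    (L : V -> {fset C}) (phi : V -> C) :=
  (forall v, phi v \in L v) /\
  (forall c, is_forest (induced G [set v | phi v == c])).

Definition list_forested_colorable (V : finType) (G : sgraph V) (k : int) :=
  forall (C : choiceType) (L : V -> {fset C}),
    (forall v, (k <= (#|` L v|)%:Z)%R) ->
    exists phi, forested_coloring G L phi.

Definition is_list_vertex_arboricity (V : finType) (G : sgraph V) :=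
  is_least (list_forested_colorable G).

(* Main.v *)
(* A coloring of G is a transversal of the cover in which (u, q) and (v, q) are
   adjacent whenever uv is an edge. With f = 2 on the allowed colors and f = 0
   elsewhere, a strictly f-degenerate transversal only uses allowed colors, and
   contains no cycle, since all vertices of a cycle have degree at least 2.
   The two parameters exist as least integers because, V(G) being nonempty,
   f = 0 (resp. empty lists) excludes all nonpositive integers. *)
Require Import Defs.
From mathcomp Require Import all_boot all_order all_algebra finmap zify.
From Stdlib Require Import Classical.

Import Order.TTheory GRing.Theory Num.Theory.

Set Implicit Arguments.
Unset Strict Implicit.
Unset Printing Implicit Defensive.

(** Well-ordering of the nonnegative integers, by induction on a natural upper bound [n] of a
    witness: either the witness is minimal or a smaller one satisfies the bound [n - 1]. Excluded
    middle decides which, as [P] is an arbitrary predicate. *)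
Lemma is_least_exists (P : int -> Prop) (k : int) :
  P k -> (forall d, P d -> (0 <= d)%R) -> exists2 d, is_least P d & (d <= k)%R.
Proof.
move=> Pk P_ge0.
suff least n d : P d -> (d <= n%:Z)%R -> exists2 e, is_least P e & (e <= d)%R.
  by apply: (least `|k|%N) => //; lia.
elim: n d => [|n IHn] d Pd le_dn.
  by exists d => //; split=> // e /P_ge0; lia.
case: (classic (exists2 e, P e & (e < d)%R)) => [[e Pe lt_ed]|min_d].
  by case: (IHn e Pe) => [|e' min_e' le_e'e]; [lia | exists e' => //; lia].
exists d => //; split=> // e Pe; rewrite leNgt; apply/negP => lt_ed.
by apply: min_d; exists e.
Qed.

Definition induced_subgraph (V : finType) (G : sgraph V) (S : {set V}) :
  subgraph G.
Proof.
apply: (@Subgraph _ G S (fun x y => [&& x \in S, y \in S & adj G x y])).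
- by move=> x y; rewrite adj_sym andbCA.
- by move=> x y /and3P[].
- by move=> x y /and3P[].
Defined.

Lemma strictly_degenerate_induced (V : finType) (G : sgraph V) (f : V -> nat)
    (S : {set V}) :
  strictly_degenerate G f -> S != set0 ->
  exists2 x, x \in S & #|[set y in S | adj G x y]| < f x.
Proof.
move=> degG S_neq0.
have [x /= xS] := degG (induced_subgraph G S) S_neq0.
rewrite /sub_deg /= => deg_x; exists x => //.
suff -> : [set y in S | adj G x y] = [set y | [&& x \in S, y \in S & adj G x y]].
  by [].
by apply/setP => y; rewrite !inE xS.
Qed.

Lemma strictly_degenerate_gt0 (V : finType) (G : sgraph V) (f : V -> nat) x :
  strictly_degenerate G f -> 0 < f x.
Proof.
move=> /(@strictly_degenerate_induced _ _ _ [set x])[|y /set1P ->].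
  by apply/set0Pn; exists x; rewrite set11.
exact: leq_trans.
Qed.

Lemma ucycle_degree (V : finType) (G : sgraph V) (c : seq V) x :
  ucycle (adj G) c -> 2 < size c -> x \in c ->
  1 < #|[set y in [set z in c] | adj G x y]|.
Proof.
move=> /andP[cyc_c uniq_c] size_c /rot_to[i c' rot_c].
have := cyc_c; rewrite -(rot_cycle i) rot_c.
have := uniq_c; rewrite -(rot_uniq i) rot_c.
have := size_c; rewrite -(size_rot i) rot_c.
have in_c y : y \in c = (y \in x :: c') by rewrite -rot_c mem_rot.
case: c' in_c {rot_c} => [|y [|z t]] // in_c _ /andP[_ /andP[y_notin _]].
rewrite /cycle rcons_path.
move=> /andP[/= /andP[adj_xy _] adj_lx]; apply/card_gt1P.
(* After rotating [x] to the front, its cyclic neighbours are its successor [y] and the last entry.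
   They differ because [y] does not recur in [z :: t], which is nonempty since the cycle has length
   over 2. *)
exists y, (last z t); split.
- by rewrite !inE in_c !inE eqxx orbT.
- rewrite inE adj_sym adj_lx andbT inE in_c.
  by rewrite in_cons [_ \in y :: _]in_cons mem_last !orbT.
- by apply: contraNneq y_notin => ->; apply: mem_last.
Qed.

Lemma strictly_degenerate_forest (V : finType) (G : sgraph V) (f : V -> nat) :
  (forall x, f x <= 2) -> strictly_degenerate G f -> is_forest G.
Proof.
move=> f_le2 degG c size_c cyc_c.
have [|x] := @strictly_degenerate_induced _ _ _ [set z in c] degG.
  by case: c size_c {cyc_c} => // x c _; apply/set0Pn; exists x; rewrite !inE eqxx.
rewrite inE => /(ucycle_degree cyc_c size_c) deg_gt1 /leq_trans/(_ (f_le2 x)).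
by rewrite ltnS leqNgt deg_gt1.
Qed.

(** Injectivity keeps the image of a cycle free of repetitions. This pulls acyclicity back from the
    transversal to each color class. *)
Lemma is_forest_inj (V W : finType) (G : sgraph V) (H : sgraph W) (h : V -> W) :
  injective h -> {homo h : x y / adj G x y >-> adj H x y} ->
  is_forest H -> is_forest G.
Proof.
move=> h_inj h_homo forestH c size_c /andP[cyc_c uniq_c].
apply: (forestH (map h c)); rewrite ?size_map //.
by apply/andP; split; [apply: homo_cycle cyc_c | rewrite map_inj_uniq].
Qed.

Lemma is_transversal_section (V : finType) (s : nat) (R : {set V * 'I_s}) :
  Defs.is_transversal R -> exists r : V -> 'I_s, forall v, (v, r v) \in R.
Proof.
move=> transR; apply: (@fin_all_exists _ _ (fun v q => (v, q) \in R)) => v.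
have /eqP/cards1P[[u q] Rv] := transR v.
have : (u, q) \in R :&: [set p | p.1 == v] by rewrite Rv set11.
by rewrite !inE /= => /andP[uqR /eqP <-]; exists q.
Qed.

Definition edgeless (V : finType) : sgraph V :=
  @SGraph V (fun _ _ => false) (fun _ _ => erefl) (fun _ => erefl).

Lemma has_transversals_gt0 (V : finType) (G : sgraph V) m k :
  0 < #|V| -> has_transversals G m k -> (0 < k)%R.
Proof.
move=> /card_gt0P[v _] hasT; rewrite ltNge; apply/negP => k_le0.
(* Matchings may be empty, so the edgeless graph covers every [G]. *)
have [] // := hasT 1 (edgeless _) (fun=> 0).
- by move=> u; rewrite big1.
move=> R [/is_transversal_section[r rP] degR].
by have := strictly_degenerate_gt0 (exist _ (v, r v) (rP v)) degR.
Qed.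

Lemma has_transversals_leq (V : finType) (G : sgraph V) m n k :
  m <= n -> has_transversals G n k -> has_transversals G m k.
Proof.
move=> le_mn hasT s H f s_gt0 covH f_le; apply: hasT => // p.
exact: leq_trans le_mn.
Qed.

Lemma list_forested_colorable_gt0 (V : finType) (G : sgraph V) k :
  0 < #|V| -> list_forested_colorable G k -> (0 < k)%R.
Proof.
move=> /card_gt0P[v _] colG; rewrite ltNge; apply/negP => k_le0.
have [|phi [/(_ v)]] := colG nat (fun=> fset0).
  by move=> u; rewrite cardfs0.
by rewrite inE.
Qed.

Definition diag_cover (V : finType) (G : sgraph V) (s : nat) :
  sgraph (V * 'I_s)%type.
Proof.
apply: (@SGraph _ (fun p q => adj G p.1 q.1 && (p.2 == q.2))).
- by move=> p q; rewrite adj_sym eq_sym.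
- by move=> p; rewrite adj_irr.
Defined.

Lemma diag_coverP (V : finType) (G : sgraph V) (s : nat) :
  is_cover G (diag_cover G s).
Proof.
split=> [p q /andP[] //|p [u i] [v j]] /andP[_ /eqP /= <-] /andP[_ /eqP /= <-].
by move=> ->.
Qed.

Lemma has_transversals_list_forested (V : finType) (G : sgraph V) (k d : int) :
  0 < #|V| -> (k <= d *+ 2)%R -> has_transversals G 2 k ->
  list_forested_colorable G d.
Proof.
move=> V_gt0 le_kd hasT C L le_dL.
have k_gt0 := has_transversals_gt0 V_gt0 hasT.
(* The color type [C] may be infinite, so fibres are indexed by the union of all lists. Removing
   duplicates makes [col] injective. *)
pose colors := undup (flatten [seq enum_fset (L v) | v <- enum V]).
pose col (q : 'I_(size colors)) := tnth (in_tuple colors) q.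
have col_inj : injective col by apply/tuple_uniqP; apply: undup_uniq.
have L_colors v c : c \in L v -> c \in colors.
  move=> cL; rewrite mem_undup; apply/flatten_mapP.
  by exists v; rewrite ?mem_enum.
pose f (p : V * 'I_(size colors)) := if col p.2 \in L p.1 then 2 else 0.
have f_le2 p : f p <= 2 by rewrite /f; case: ifP.
have sum_f v : \sum_(q < size colors) f (v, q) = #|` L v| * 2.
  (* Summing over colors instead of indices reduces the claim to counting the entries of [colors] in
     [L v], which are a permutation of [L v]. *)
  transitivity (\sum_(c <- colors) (if c \in L v then 2 else 0)).
    by rewrite [RHS](big_tnth _ _ colors).
  rewrite -big_mkcond big_const_seq iter_addn_0 mulnC; congr (_ * _).
  rewrite -size_filter; apply/perm_size/uniq_perm.
  - by rewrite filter_uniq ?undup_uniq.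
  - exact: fset_uniq.
  move=> c; rewrite mem_filter.
  by apply: andb_idr; apply: L_colors.
(* Fibres must be nonempty: [0 < k] and [k <= d *+ 2] give [0 < d], so no list is empty. *)
have colors_gt0 : 0 < size colors.
  have /card_gt0P[v _] := V_gt0; rewrite lt0n size_eq0; apply/eqP => colors0.
  have := le_dL v; suff -> : L v = fset0 by rewrite cardfs0; lia.
  by apply/fsetP => c; rewrite inE; apply/negP => /L_colors; rewrite colors0.
have [|R [transR degR]] := hasT _ _ f colors_gt0 (diag_coverP G _) f_le2.
  by move=> v; rewrite sum_f; have := le_dL v; lia.
have [r rP] := is_transversal_section transR.
exists (fun v => col (r v)); split=> [v | c].
  have := strictly_degenerate_gt0 (exist _ (v, r v) (rP v)) degR.
  by rewrite /f /=; case: ifP.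
(* The map [v] to [(v, r v)] embeds a color class into the transversal: equal colors have equal
   indices, so every edge of [G] inside the class lifts to the cover. *)
apply: (@is_forest_inj _ _ _ (induced (diag_cover G (size colors)) R)
  (fun v => exist _ (val v, r (val v)) (rP (val v)))).
- by move=> u v [/val_inj].
- move=> [u uc] [v vc] /= adj_uv; apply/andP; split=> //=.
  apply/eqP/col_inj.
  by move: uc vc; rewrite !inE => /eqP -> /eqP ->.
- by apply: strictly_degenerate_forest degR => x; apply: f_le2.
Qed.

Unset Implicit Arguments.

Theorem proposition2 (V : finType) (G : sgraph V) (k : int)
    (V_nonempty : 0 < #|V|)
    (transversals : forall (s : nat) (H : sgraph (V * 'I_s)%type)
        (f : V * 'I_s -> nat),
      0 < s -> is_cover G H ->
      (forall p, f p <= 2) ->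
      (forall v, (k <= (\sum_(q < s) f (v, q))%:Z)%R) ->
      exists R, strictly_degenerate_transversal H f R) :
  DP_colorable G k /\
  exists2 d, is_list_vertex_arboricity G d &
             (d <= Num.ceil (k%:~R / 2%:R : rat))%R.
Proof.
split.
  apply: is_least_exists => [|d /(has_transversals_gt0 V_nonempty)/ltW //].
  exact: has_transversals_leq transversals.
apply: is_least_exists => [|d /(list_forested_colorable_gt0 V_nonempty)/ltW //].
apply: has_transversals_list_forested transversals => //.
(* Clearing the denominator in the rationals turns this into the integer inequality between [k] and
   twice the ceiling. *)
have := ceil_ge (k%:~R / 2%:R : rat).
by rewrite ler_pdivrMr // mulr_natr -raddfMn /= ler_int.
Qed.
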